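(* Let $G$ be a finite group. Then $s_2(G)=|G|-2$ if and only if one of the following holds: (a) $G\cong C_3$; (b) $G$ is dihedral of order $6$; (c) $G\cong (C_2)^j\times C_4$ for some non-negative integer $j$; (d) $G\cong (C_2)^j\times E$ for some non-negative integer $j$ and some extra-special $2$-group $E$; (e) $G\cong (C_2)^j\times (C_4*E)$ for some non-negative integer $j$ and some extra-special $2$-group $E$, where $C_4*E$ is the central product of $E$ with $C_4$ (of order $2|E|$).
   Context: A subset $X$ of a finite group $G$ is called $2$-power-avoiding if $\{g,g^2\}\not\subseteq X$ for every $g\in G$ (in particular $1\notin X$). Define $s_2(G)=\max\{|X| : X\subseteq G \text{ is } 2\text{-power-avoiding}\}$. $C_n$ denotes the cyclic group of order $n$. A finite $p$-group $E$ is extra-special if its centre $Z(E)$ has order $p$ and $E/Z(E)$ is non-trivial and elementary abelian. For an extra-special $2$-group $E$, the central product $C_4*E$ is the quotient of $C_4\times E$ obtained by identifying the unique subgroup of order $2$ of $C_4$ with $Z(E)$, i.e. the quotient by the subgroup $\langle (x^2,z)\rangle$ of order $2$, where $x$ generates $C_4$ and $z$ generates $Z(E)$. *)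

(* Defs.v *)
From HB Require Import structures.
From mathcomp Require Import all_boot all_fingroup all_algebra all_solvable.

Set Implicit Arguments.
Unset Strict Implicit.
Unset Printing Implicit Defensive.

Import GroupScope.

Definition two_power_avoiding (gT : finGroupType) (G X : {set gT}) : bool :=
  [forall g in G, ~~ ([set g; g ^+ 2] \subset X)].

Definition s_two (gT : finGroupType) (G : {set gT}) : nat :=
  \max_(X : {set gT} | (X \subset G) && two_power_avoiding G X) #|X|.

(* The external direct power (C_2)^j, trivial for j = 0. *)
Definition C2pow (j : nat) : {group {dffun forall _ : 'I_j, 'Z_2}} :=
  [group of setXn (fun _ : 'I_j => [set: 'Z_2]%G)].

(* The quotient of C_4 x E by <(x^2, z)>, where x is meant to generate C_4 and
   z to generate Z(E). When #|Z(E)| = 2, both x^2 and z are then uniquely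
   determined, and <(x^2, z)> is central, hence normal, in C_4 x E. *)
Definition C4_cprod (eT : finGroupType) (E : {group eT}) (x : 'Z_4) (z : eT) :
    {group coset_of <[(x ^+ 2, z)]>} :=
  (setX [set: 'Z_4] E / <[(x ^+ 2, z)]>)%G.

(* The library's [extraspecial A] asks that the Frattini and derived subgroups
   of A both equal Z(A), of prime order. For p-groups it coincides with the
   definition through the central quotient. *)
Fact extraspecial_central_quotient (p : nat) (eT : finGroupType)
    (E : {group eT}) : prime p -> p.-group E ->
  extraspecial E <->
    [/\ #|'Z(E)| = p, E / 'Z(E) != 1 & p.-abelem (E / 'Z(E))].
Proof.
move=> p_pr pE; have nZE := normal_norm (center_normal E).
have abEP : (E / 'Z(E) == 1) = abelian E.
  by rewrite -subG1 quotient_sub1 // subsetI subxx.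
split=> [esE | [oZ ntEZ abEZ]].
  have [[PhiZ derZ] prZ] := esE.
  split; first exact: card_center_extraspecial pE esE.
    rewrite abEP; apply/negP => /derG1P der1.
    by move: prZ; rewrite -derZ der1 cards1.
  by rewrite -PhiZ Phi_quotient_abelem.
have prZ: prime #|'Z(E)| by rewrite oZ.
have sPhiZ: 'Phi(E) \subset 'Z(E) by apply: Phi_min pE nZE abEZ.
have sderPhi: E^`(1) \subset 'Phi(E) by rewrite (Phi_joing pE) joing_subl.
have sZder: 'Z(E) \subset E^`(1).
  have [//|tiZ] := prime_subgroupVti E^`(1)%G prZ.
  case/negP: ntEZ; rewrite abEP; apply/derG1P.
  by rewrite -tiZ; apply/esym/setIidPl/(subset_trans sderPhi).
split=> //; split; apply/eqP; rewrite eqEsubset.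
  by rewrite sPhiZ (subset_trans sZder).
by rewrite (subset_trans sderPhi) ?sZder.
Qed.

(* Main.v *)
(** A set is 2-power-avoiding exactly when its complement Y meets every
    {g, g^2}; taking g = 1 forces 1 into Y.  Hence s_2(G) = |G| - 2 means that
    G is not of exponent at most 2 and that some Y = {1, y} works: every g <> y
    has g^2 = 1 or g^2 = y.

    If y^2 <> 1, applying this to y^-1 gives y^3 = 1, every element outside
    <y> is an involution inverting y, and so |G : <y>| <= 2: G is C_3 or D_6.

    If y^2 = 1, then y is the only nontrivial square, so it is central and
    G / <y> is elementary abelian.  If E / <y> is a complement to Z(G) / <y>,
    then G = Z(G) E with Z(G) and E meeting in <y>, and E is either <y> or
    extraspecial.  Moreover Z(G) = <c> x A with A elementary abelian and c = y
    or c^2 = y, so G = A x <c>E. *)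

Require Import Defs.
From HB Require Import structures.
From mathcomp Require Import all_boot all_fingroup all_algebra all_solvable.
Set Implicit Arguments.
Unset Strict Implicit.

Import GroupScope.

(* [[set 1; y]] meets every [[set g; g ^+ 2]], and [[set 1]] does not. *)
Definition hits_squares (gT : finGroupType) (G : {set gT}) (y : gT) : Prop :=
  [/\ y \in G^#, {in G, forall g, [|| g == y, g ^+ 2 == 1 | g ^+ 2 == y]}
    & exists2 g, g \in G & g ^+ 2 != 1].

(** This is the case [y ^+ 2 = 1] of [hits_squares]. The last clause makes [y] an actual square,
    which also puts it in [G] and excludes exponent 2. *)
Definition unique_square (gT : finGroupType) (G : {set gT}) (y : gT) : Prop :=
  [/\ {in G, forall g, g ^+ 2 \in [set 1; y]}, y != 1
    & exists2 g, g \in G & g ^+ 2 = y].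

(** * Avoiding sets and their two-element complements *)

Lemma two_power_avoidingP (gT : finGroupType) (G X : {set gT}) :
  reflect {in G, forall g, g \in X -> g ^+ 2 \notin X} (two_power_avoiding G X).
Proof.
apply: (iffP forall_inP) => avX g Gg; have := avX g Gg;
  by rewrite subUset !sub1set negb_and -implybE => /implyP.
Qed.

Lemma s_two_hitting (gT : finGroupType) (G : {group gT}) :
  (s_two G + 2 = #|G|)%N <-> exists y, hits_squares G y.
Proof.
have no1 (X : {set gT}) : two_power_avoiding G X -> 1 \notin X.
  move/two_power_avoidingP/(_ 1 (group1 G)); rewrite expg1n.
  by case: (1 \in X) => // /(_ isT).
have cardD1 : (#|G^#| + 1 = #|G|)%N.
  by rewrite [#|G|](cardsD1 1) group1 addnC.
split=> [s2G | [y [/setD1P[y1 Gy] hity [g Gg g2]]]].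
  have [X /andP[sXG avX] mX] : {X : {set gT} |
      (X \subset G) && two_power_avoiding G X & s_two G = #|X|}.
    (* The maximum is attained because the empty set is avoiding. *)
    apply: eq_bigmax_cond; apply/card_gt0P; exists set0.
    rewrite unfold_in sub0set; apply/two_power_avoidingP=> g _.
    by rewrite inE.
  have cD: #|G :\: X| = 2.
    by rewrite cardsD (setIidPr sXG) -s2G mX addnC addnK.
  have D1: 1 \in G :\: X by rewrite inE no1 ?group1.
  have [y defY]: exists y, (G :\: X) :\ 1 = [set y].
    by apply/cards1P; move/eqP: cD; rewrite (cardsD1 1) D1 eqSS.
  have: y \in (G :\: X) :\ 1 by rewrite defY set11.
  rewrite !inE => /and3P[y1 y'X Gy].
  exists y; split; first by rewrite !inE y1.
    move=> g Gg; have [// | gy /=] := eqVneq g y.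
    have [-> | g1] := eqVneq g 1; first by rewrite expg1n eqxx.
    have Xg: g \in X.
      apply: contraNT gy => Xg.
      by rewrite -in_set1 -defY !inE g1 Xg.
    have /two_power_avoidingP/(_ g Gg Xg) g2X := avX.
    have [//|g21 /=] := eqVneq (g ^+ 2) 1.
    by rewrite -in_set1 -defY !inE g21 g2X groupX.
  (* If all squares were trivial, [G^#] would be avoiding, and the maximum would be at least |G| -
     1. *)
  apply/exists_inP; apply: contraT; rewrite negb_exists_in => /forall_inP sqG.
  have : #|G^#| <= s_two G.
    apply: (@leq_bigmax_cond _ _ (fun X : {set gT} => #|X|)).
    rewrite subsetDl; apply/two_power_avoidingP=> g Gg _.
    by rewrite inE (eqP (negbNE (sqG g Gg))) set11.
  by rewrite -(leq_add2r 1) cardD1 -s2G leq_add2l.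
apply/eqP; rewrite eqn_leq; apply/andP; split; last first.
  (* Lower bound: G without 1 and [y] is avoiding. *)
  have <-: (#|G^# :\ y| + 2 = #|G|)%N.
    by rewrite -cardD1 [#|G^#|](cardsD1 y) !inE y1 Gy add1n addn1 addn2.
  rewrite leq_add2r.
  apply: (@leq_bigmax_cond _ _ (fun X : {set gT} => #|X|)).
  rewrite (subset_trans (subsetDl _ _) (subsetDl _ _)).
  apply/two_power_avoidingP=> h Gh.
  rewrite !inE => /andP[hy _]; have := hity h Gh; rewrite (negPf hy) /=.
  by case/orP=> /eqP->; rewrite eqxx ?andbF.
(* Upper bound: an avoiding set lies in [G^#] and differs from it, since [g] and [g ^+ 2] both
   belong to [G^#]. The strict bound is passed through the predecessor of [#|G^#|], hence the
   positivity [D0]. *)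
rewrite -cardD1 addn2 addn1 ltnS.
have D0: 0 < #|G^#| by apply/card_gt0P; exists y; rewrite !inE y1.
rewrite -(prednK D0) ltnS; apply/bigmax_leqP => X /andP[sXG avX].
rewrite -ltnS (prednK D0).
apply: proper_card; rewrite properEneq subsetD1 sXG no1 // !andbT.
  apply: contraL avX => /eqP->; apply/two_power_avoidingP=> /(_ g Gg).
  have g1: g != 1 by apply: contraNneq g2 => ->; rewrite expg1n.
  by rewrite !inE g1 Gg g2 groupX // => /(_ isT).
Qed.

Lemma hits_squares_injm (gT rT : finGroupType) (G : {group gT}) 
    (f : {morphism G >-> rT}) y :
  'injm f -> hits_squares G y -> hits_squares (f @* G) (f y).
Proof.
move=> injf [/setD1P[y1 Gy] hity [g Gg g2]].
have f1 x : x \in G -> (f x == 1) = (x == 1).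
  by move=> Gx; rewrite -(inj_in_eq (injmP injf)) ?morph1.
split.
- by rewrite !inE f1 // y1 mem_morphim.
- move=> _ /morphimP[x _ Gx ->]; rewrite -morphX // f1 ?groupX //.
  by rewrite !(inj_in_eq (injmP injf)) ?groupX // hity.
- by exists (f g); rewrite ?mem_morphim // -morphX // f1 ?groupX.
Qed.

Lemma hits_squares_isog (gT rT : finGroupType) (G : {group gT})
    (H : {group rT}) :
  G \isog H -> (exists y, hits_squares H y) -> exists y, hits_squares G y.
Proof.
rewrite isog_sym => /isogP[f injf <-] [y hy].
by exists (f y); apply: hits_squares_injm.
Qed.

(** * Groups with one nontrivial square, and elementary abelian factors *)

(** As a square, [y] lies in [G], so its own square is 1 or [y]; the latter would force [y = 1]. *)
Lemma unique_square_order2 {gT : finGroupType} {G : {group gT}} {y} :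
  unique_square G y -> #[y] = 2 /\ y \in G.
Proof.
case=> sqG y1 [g Gg g2].
have Gy: y \in G by rewrite -g2 groupX.
split=> //; apply: nt_prime_order => //.
have := sqG y Gy; rewrite !inE => /orP[/eqP// | /eqP].
by rewrite expgS expg1 -[RHS]mulg1 => /mulgI e; rewrite e eqxx in y1.
Qed.

Lemma unique_square_hits (gT : finGroupType) (G : {group gT}) y :
  unique_square G y -> hits_squares G y.
Proof.
move=> uG; have [_ Gy] := unique_square_order2 uG.
case: uG => sqG y1 [g Gg g2].
split; first by rewrite !inE y1.
  by move=> x Gx; have := sqG x Gx; rewrite !inE => ->; rewrite orbT.
by exists g => //; rewrite g2.
Qed.

Lemma pair_sqr (gT rT : finGroupType) (u : gT * rT) :
  u ^+ 2 = (u.1 ^+ 2, u.2 ^+ 2).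
Proof. by []. Qed.

Lemma unique_square_setX (gT rT : finGroupType) (A : {group gT})
    (H : {group rT}) y :
  {in A, forall a, a ^+ 2 = 1} -> unique_square H y ->
  unique_square (setX A H) (1, y).
Proof.
move=> sqA [sqH y1 [h Hh h2]]; split.
- case=> a g /setXP[Aa Hg]; rewrite pair_sqr !inE !xpair_eqE sqA // eqxx.
  by rewrite -in_set2 sqH.
- by rewrite xpair_eqE negb_and y1 orbT.
- by exists (1, h); rewrite ?inE /= ?group1 // pair_sqr expg1n h2.
Qed.

Lemma C2pow_sqr j : {in C2pow j, forall a, a ^+ 2 = 1}.
Proof.
move=> a _; apply/ffunP=> i; rewrite expgS expg1 !ffunE.
by case: (a i) => [[|[|m]]] // Hm; apply: val_inj.
Qed.

Lemma abelem_isog_C2pow (gT : finGroupType) (A : {group gT}) :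
  2.-abelem A -> exists j, A \isog C2pow j.
Proof.
move=> abA; exists (logn 2 #|A|).
rewrite (isog_abelem_card _ abA) exponent2_abelem /=.
  rewrite cardsXn (eq_bigr (fun _ => 2)) => [|i _]; last by rewrite cardsT card_ord.
  by rewrite prod_nat_const card_ord -(card_pgroup (abelem_pgroup abA)).
by apply/exponentP=> a; apply: C2pow_sqr.
Qed.

Lemma sqr1_invg (gT : finGroupType) (g : gT) : g ^+ 2 = 1 -> g^-1 = g.
Proof. by move=> g2; apply/eqP; rewrite eq_invg_mul; apply/eqP. Qed.

(** * The case of [y] of order 3: cyclic of order 3 and dihedral of order 6 *)

Lemma hits_squares_C3 : exists y, hits_squares [set: 'Z_3] y.
Proof.
exists Zp1; split; first by rewrite !inE.
  by move=> [[|[|[|m]]] Hm] _.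
by exists Zp1.
Qed.

Lemma hits_squares_D6 : exists y, hits_squares [set: 'D_6] y.
Proof.
have isoD : [set: 'D_6] \isog Grp (x : y : x ^+ 3, y ^+ 2, x ^ y = x^-1).
  exact: (@Grp_dihedral 3).
have oD : #|[set: 'D_6]| = 6 by apply: (@card_dihedral 3).
have /existsP[[x s] /= /eqP[genD x3 s2 xs]] := isoGrp_hom isoD.
have nxs : <[s]> \subset 'N(<[x]>).
  by rewrite cycle_subG /=; apply/normP; rewrite -cycleJ xs cycleV.
have defD : <[x]> * <[s]> = [set: 'D_6].
  by rewrite -norm_joinEr // -genD /= joing_idl joing_idr.
(* The relations only bound the orders of [x] and [s] from above; the group order 6 is at most their
   product, which forces [x] to have order 3. *)
have xm : #[x] <= 3 by rewrite dvdn_leq // order_dvdn x3.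
have sm : #[s] <= 2 by rewrite dvdn_leq // order_dvdn s2.
have oxs : 6 <= #[x] * #[s].
  have /eqP := mul_cardG <[x]> <[s]>; rewrite defD oD -!orderE => /eqP->.
  by rewrite leq_pmulr // cardG_gt0.
have ox : #[x] = 3.
  apply/eqP; rewrite eqn_leq xm -(leq_pmul2r (isT : 0 < 2)).
  by rewrite (leq_trans oxs) // leq_mul2l sm orbT.
have inv i : (x ^+ i) ^ s = x ^- i by rewrite conjXg xs expVgn.
exists x; split.
- by rewrite !inE -order_gt1 ox.
- move=> g; rewrite -defD => /mulsgP[_ _ /cycleP[i ->] /cycleP[k ->] ->].
  (* Only the parity of [k] matters. Elements [x ^+ i * s] square to 1 because [s] inverts [x];
     among the powers of [x], the square of [x ^+ 2] is [x]. *)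
  have -> : s ^+ k = s ^+ odd k.
    by rewrite -[in LHS](odd_double_half k) expgD -mul2n expgM s2 expg1n mulg1.
  case: (odd k); last first.
    rewrite expg0 mulg1 -(expg_mod i x3).
    have := ltn_pmod i (isT : 0 < 3); case: (i %% 3) => [|[|[|//]]] _.
    - by rewrite expg0 expg1n eqxx orbT.
    - by rewrite expg1 eqxx.
    - have -> : (x ^+ 2) ^+ 2 = x by rewrite -expgM (expgD x 3 1) x3 mul1g.
      by rewrite eqxx !orbT.
  have <- : (x ^+ i * s) ^+ 2 = 1; last by rewrite eqxx orbT.
  have := inv i; rewrite conjgE (sqr1_invg s2) => sxs.
  by rewrite expgS expg1 -mulgA sxs mulgV.
- by exists x; rewrite ?inE // -order_dvdn ox.
Qed.

Lemma hits_squares_order3 (gT : finGroupType) (G : {group gT}) y :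
  hits_squares G y -> y ^+ 2 != 1 -> G \isog [set: 'Z_3] \/ G \isog 'D_6.
Proof.
case=> /setD1P[y1 Gy] hity _ y2.
have yV : y^-1 != y by rewrite eq_invg_mul -[y in y * _]expg1 -expgSr.
have y3 : y ^+ 3 = 1.
  have := hity _ (groupVr Gy).
  rewrite (negPf yV) /= expVgn invg_eq1 (negPf y2) /= => /eqP e.
  by rewrite expgSr -[y in _ * y]e mulgV.
have oy : #[y] = 3 by apply: nt_prime_order.
(* If [g ^+ 2 = y], then the inverse of [g] has square [y^-1], which is neither 1 nor [y], a
   contradiction. *)
have invol g : g \in G -> g \notin <[y]> -> g ^+ 2 = 1.
  move=> Gg Yg.
  have gy : g != y by apply: contraNneq Yg => ->; apply: cycle_id.
  have := hity g Gg; rewrite (negPf gy) /= => /orP[/eqP// | /eqP g2].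
  have gVy : g^-1 != y.
    by apply: contraNneq Yg => <-; rewrite cycleV cycle_id.
  have := hity _ (groupVr Gg); rewrite (negPf gVy) /= expVgn g2 invg_eq1.
  by rewrite (negPf y1) (negPf yV).
have [sGY | ] := boolP (G \subset <[y]>).
  left; have -> : G :=: <[y]> by apply/eqP; rewrite eqEsubset sGY cycle_subG.
  rewrite isog_cyclic_card ?cycle_cyclic // -orderE oy cardsT card_ord eqxx andbT.
  by apply/cyclicP; exists Zp1; apply: Zp_cycle.
case/subsetPn=> s Gs Ys; right.
have s2 := invol s Gs Ys.
(* Both [g] and [g * y] lie outside [<[y]>], so both square to 1, and [g] inverts [y]. *)
have ys g : g \in G -> g \notin <[y]> -> y ^ g = y^-1.
  move=> Gg Yg; have g2 := invol g Gg Yg.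
  have Ygy : g * y \notin <[y]> by rewrite groupMr // cycle_id.
  have := invol _ (groupM Gg Gy) Ygy.
  rewrite conjgE (sqr1_invg g2) => gygy; apply: (mulIg y).
  by rewrite mulVg -gygy expgS expg1 !mulgA.
have defG : G :=: <[y]> <*> <[s]>.
  apply/eqP; rewrite eqEsubset join_subG !cycle_subG Gy Gs !andbT.
  apply/subsetP=> g Gg; have [Yg | Yg] := boolP (g \in <[y]>).
    exact: (subsetP (joing_subl _ _)).
  (* Both [g] and [s] invert [y], so [g * s] centralises it; outside [<[y]>] it would have to invert
     [y]. *)
  suff: g * s \in <[y]>.
    move=> Ygs; rewrite -(mulgK s g) groupMr ?groupV.
      exact: (subsetP (joing_subl _ _)).
    by rewrite (subsetP (joing_subr _ _)) ?cycle_id.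
  apply: contraT => Ygs.
  have := ys _ (groupM Gg Gs) Ygs.
  by rewrite conjgM ys // conjVg ys // invgK => /eqP; rewrite eq_sym (negPf yV).
have oG : #|G| = 6.
  have nys : <[s]> \subset 'N(<[y]>).
    by rewrite cycle_subG /=; apply/normP; rewrite -cycleJ ys // cycleV.
  have s1 : s != 1 by apply: contraNneq Ys => ->.
  rewrite defG norm_joinEr // coprime_cardMg -!orderE oy.
    by rewrite (nt_prime_order _ s2).
  by rewrite (nt_prime_order _ s2).
(* The pair [(y, s)] satisfies the dihedral presentation, so [G] is an image of ['D_6], and the
   orders agree. *)
rewrite isogEcard oG (@card_dihedral 3) // andbT (@Grp_dihedral 3) //.
apply/existsP; exists (y, s) => /=.
by rewrite !xpair_eqE y3 s2 ys // !eqxx defG /= joing_idl joing_idr eqxx.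
Qed.

(** * Extraspecial groups, [C_4] and their central products have one nontrivial square *)

(** Squares lie in the Frattini subgroup, which is the centre {1, z}. Were [z] not a square, [E]
    would have exponent 2 and be abelian. *)
Lemma extraspecial_unique_square (gT : finGroupType) (E : {group gT}) z :
  2.-group E -> extraspecial E -> generator 'Z(E) z -> unique_square E z.
Proof.
move=> pE esE /eqP defZ; have [[defPhi _] _] := esE.
have oz : #[z] = 2 by rewrite orderE -defZ (card_center_extraspecial pE esE).
have sqE : {in E, forall g, g ^+ 2 \in [set 1; z]}.
  move=> g Eg; rewrite -cycle2g // -defZ -defPhi (Phi_joing pE).
  apply: (subsetP (joing_subr _ _)); apply: (Mho_p_elt 1) => //.
  exact: mem_p_elt pE Eg.
split; first by [].
  by rewrite -order_gt1 oz.
apply/exists_eq_inP/contraT; rewrite negb_exists_in => /forall_inP sq1.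
have/negP[] := extraspecial_nonabelian esE.
apply: abelem_abelian (exponent2_abelem _); apply/exponentP=> g Eg.
by have := sqE g Eg; rewrite !inE (negPf (sq1 g Eg)) orbF => /eqP.
Qed.

Lemma unique_square_cycle4 (gT : finGroupType) (x : gT) :
  #[x] = 4 -> unique_square <[x]> (x ^+ 2).
Proof.
move=> ox; have ox2 : #[x ^+ 2] = 2 by rewrite orderXdiv ox.
split.
- move=> _ /cycleP[i ->]; rewrite -cycle2g // -expgM mulnC expgM.
  exact: mem_cycle.
- by rewrite -order_gt1 ox2.
- by exists x; rewrite ?cycle_id.
Qed.

Lemma generator_Z4 (x : 'Z_4) : generator [set: 'Z_4] x -> #[x] = 4.
Proof. by move=> /eqP gx; rewrite orderE -gx cardsT card_ord. Qed.

(** The nontrivial square is the image of (1, z), which is also that of (x^2, 1). Squares in the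
    direct product have components in {1, x^2} and {1, z}, and these four pairs have only two
    images. *)
Lemma C4_cprod_unique_square (gT : finGroupType) (E : {group gT}) (x : 'Z_4) z :
  2.-group E -> extraspecial E -> generator [set: 'Z_4] x ->
  generator 'Z(E) z -> exists y, unique_square (C4_cprod E x z) y.
Proof.
move=> pE esE gx gz; have uE := extraspecial_unique_square pE esE gz.
have [oz Ez] := unique_square_order2 uE.
have [sqE z1 [g Eg g2]] := uE.
have [sqx x1 _] := unique_square_cycle4 (generator_Z4 gx).
rewrite -(eqP gx) in sqx.
have z2 : z ^+ 2 = 1 by rewrite -oz expg_order.
have x22 : (x ^+ 2) ^+ 2 = 1 by have := expg_order x; rewrite (generator_Z4 gx) -expgM.
pose n := (x ^+ 2, z).
have n1 : n != 1 by rewrite xpair_eqE negb_and x1.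
have on : #[n] = 2.
  by apply: nt_prime_order; rewrite // pair_sqr /= x22 z2.
have Zz : z \in 'Z(E) by rewrite (eqP gz) cycle_id.
have nE : setX [set: 'Z_4] E \subset 'N(<[n]>).
  apply: cents_norm; rewrite centsC cycle_subG.
  apply/centP=> -[a e] /setXP[_ Ee]; congr (_, _); first exact: Zp_mulgC.
  by case/setIP: Zz => _ /centP; apply.
have Nz : (1, z) \in 'N(<[n]>) by rewrite (subsetP nE) // inE /= group1.
exists (coset <[n]> (1, z)); split.
- move=> _ /morphimP[[a e] Nu /setXP[_ Ee] ->].
  rewrite -morphX // pair_sqr /=.
  have := sqE e Ee; have := sqx a (in_setT a); rewrite !inE.
  case/orP=> /eqP-> /orP[]/eqP->.
  + by rewrite morph1 eqxx.
  + by rewrite eqxx orbT.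
  + have -> : (x ^+ 2, 1) = n * (1, z) :> 'Z_4 * gT.
      by congr (_, _); rewrite ?mulg1 // -z2 expgS expg1.
    by rewrite coset_kerl ?cycle_id // eqxx orbT.
  + by rewrite (coset_id (cycle_id n)) eqxx.
- apply/eqP=> /(coset_idr Nz).
  by rewrite /= cycle2g // !inE !xpair_eqE (negPf z1) andbF eq_sym (negPf x1).
- exists (coset <[n]> (1, g)).
    by apply: mem_quotient; rewrite inE /= group1.
  rewrite -morphX ?pair_sqr /= ?expg1n ?g2 //.
  by apply: (subsetP nE); rewrite inE /= group1.
Qed.

(** * Recognising the central product inside a group *)

(** The exponent is the representative of [u.1] below 4, so multiplicativity relies on [c] having
    order 4 as well as on [c] centralising the second factor. *)
Definition C4_mul (gT : finGroupType) (c : gT) (u : 'Z_4 * gT) : gT :=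
  c ^+ u.1 * u.2.

Lemma C4_mulM (gT : finGroupType) (E : {group gT}) c :
    #[c] = 4 -> c \in 'C(E) ->
  {in setX [set: 'Z_4] E &, {morph C4_mul c : u v / u * v}}.
Proof.
move=> oc cEc [a e] [b h] /setXP[_ Ee] /setXP[_ Eh].
(* The group law of ['Z_4] is addition modulo 4. *)
change (c ^+ (a * b : 'Z_4)%g * (e * h) = (c ^+ a * e) * (c ^+ b * h)).
have -> : c ^+ (a * b : 'Z_4)%g = c ^+ a * c ^+ b.
  by rewrite -expgD -(expg_mod (a + b) (expg_order c)) oc.
rewrite -!mulgA; congr (_ * _); rewrite !mulgA; congr (_ * _).
exact/commute_sym/commuteX/commute_sym/(centP cEc).
Qed.

(** First isomorphism theorem for the multiplication map, whose image is [<[c]> * E]. *)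
Lemma C4_cprod_isog (gT : finGroupType) (E : {group gT}) c :
    #[c] = 4 -> c \in 'C(E) -> <[c]> :&: E = <[c ^+ 2]> ->
  <[c]> <*> E \isog C4_cprod E Zp1 (c ^+ 2).
Proof.
move=> oc cEc tiE; pose f := Morphism (C4_mulM oc cEc).
have oc2 : #[c ^+ 2] = 2 by rewrite orderXdiv oc.
have defK : <[c]> <*> E = <[c]> * E.
  by rewrite cent_joinEr // centsC cycle_subG.
have imC : f @* (setX [set: 'Z_4] E) = <[c]> * E.
  apply/setP=> g; apply/morphimP/mulsgP.
    case=> -[a e] _ /setXP[_ Ee] ->.
    by exists (c ^+ a) e; rewrite ?mem_cycle.
  case=> _ e /cyclePmin[i li ->] Ee ->; rewrite oc in li.
  by exists (Ordinal li, e); rewrite ?inE.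
have Ec2 : c ^+ 2 \in E.
  by have := cycle_id (c ^+ 2); rewrite -tiE => /setIP[].
(* The pair is in the kernel since c^2 c^2 = c^4 = 1. Equality is a count: the domain has order
   4|E|, and the image has half that order because [<[c]>] meets [E] in a subgroup of order 2. *)
have kerC : 'ker f = <[(Zp1 ^+ 2, c ^+ 2)]>.
  apply/esym/eqP; rewrite eqEcard cycle_subG; apply/andP; split.
    apply/kerP; rewrite ?inE //= /C4_mul /= -expgD.
    by change (c ^+ 4 = 1); rewrite -oc expg_order.
  have n2 : #[(Zp1 ^+ 2, c ^+ 2) : 'Z_4 * gT] = 2.
    apply: nt_prime_order; rewrite ?pair_sqr //.
    congr (_, _); first exact: val_inj.
    by have := expg_order (c ^+ 2); rewrite oc2.
  have /eqP := mul_cardG <[c]> E; rewrite tiE -!orderE oc oc2 => /eqP oK.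
  have K0 : 0 < #|<[c]> * E| by rewrite -defK cardG_gt0.
  rewrite [X in _ <= X]n2 -(leq_pmul2l K0) -oK -imC.
  rewrite -(card_isog (first_isog f)) card_quotient ?ker_norm //.
  by rewrite mulnC Lagrange ?subsetIl // cardsX cardsT card_ord.
have := first_isog f.
by rewrite /= imC kerC isog_sym /= defK.
Qed.

(** * Decomposition of a group with one nontrivial square *)

(** In exponent 2, split off [<[y]>]. Otherwise take [c] with square [y] and split the subgroup [W]
    of elements of square 1 as [<[y]> \x A]. Any element of square [y] lies in c W, so [<[c]>] and
    [A] generate; a power of [c] in [A] has square 1, hence lies in [<[y]>] and is trivial. *)
Lemma abelian_unique_square_split (gT : finGroupType) (Z : {group gT}) y :
    abelian Z -> #[y] = 2 -> y \in Z -> {in Z, forall g, g ^+ 2 \in [set 1; y]} ->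
  exists c, exists A : {group gT},
    [/\ 2.-abelem A, <[c]> \x A = Z & c = y \/ c ^+ 2 = y].
Proof.
move=> abZ oy Zy sqZ; have y2 : y ^+ 2 = 1 by rewrite -oy expg_order.
have com : {in Z &, forall g h, commute g h}.
  by move=> g h Zg Zh; apply: (centsP abZ).
have [abe | ] := boolP [forall g in Z, g ^+ 2 == 1].
  have abeZ : 2.-abelem Z.
    by apply/exponent2_abelem/exponentP=> g /(forall_inP abe)/eqP.
  have [A defZ] := abelem_split_dprod abeZ (etrans (cycle_subG y Z) Zy).
  exists y, A; split=> //; last by left.
  by apply: abelemS abeZ; case/dprodP: defZ => _ <- _ _; apply: mulG_subr.
rewrite negb_forall_in => /exists_inP[c Zc c2].
have {}c2 : c ^+ 2 = y.
  by have := sqZ c Zc; rewrite !inE (negPf c2) => /eqP.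
have y1 : y != 1 by rewrite -order_gt1 oy.
have oc : #[c] = 4.
  by rewrite (@orderXprime _ 2 2 c) ?c2 ?oy.
pose W := [set g in Z | g ^+ 2 == 1].
have gW : group_set W.
  apply/group_setP; split; first by rewrite !inE group1 expg1n eqxx.
  move=> g h; rewrite !inE => /andP[Zg /eqP g2] /andP[Zh /eqP h2].
  by rewrite groupM // expgMn ?g2 ?h2 ?mulg1 //=; apply: com.
have abW : 2.-abelem (Group gW).
  by apply/exponent2_abelem/exponentP=> g; rewrite inE => /andP[_ /eqP].
have sYW : <[y]> \subset Group gW by rewrite cycle_subG inE Zy y2 eqxx.
have [A defW] := abelem_split_dprod abW sYW.
have [_ /= YA _ tiYA] := dprodP defW.
have sAW : A \subset Group gW by rewrite /= -YA mulG_subr.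
have sWZ : Group gW \subset Z by apply/subsetP=> g; rewrite inE => /andP[].
have sAZ := subset_trans sAW sWZ.
exists c, A; split; first exact: abelemS abW; last by right.
rewrite dprodE.
- apply/eqP; rewrite eqEsubset mul_subG ?cycle_subG //=.
  apply/subsetP=> g Zg; have := sqZ g Zg; rewrite !inE => /orP[] /eqP g2.
    have : g \in W by rewrite inE Zg g2 eqxx.
    rewrite -YA; apply/subsetP/mulSg; rewrite cycle_subG -c2; exact: mem_cycle.
  have : c^-1 * g \in W.
    rewrite inE groupM ?groupV // expgMn ?expVgn ?c2 ?g2 ?mulVg ?eqxx //.
    by apply: com; rewrite ?groupV.
  rewrite -YA => /mulsgP[u a Yu Aa e].
  apply/mulsgP; exists (c * u) a => //; last by rewrite -mulgA -e mulKVg.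
  rewrite groupM ?cycle_id //; apply: (subsetP _ _ Yu).
  by rewrite cycle_subG -c2 mem_cycle.
- by apply: (sub_abelian_cent2 abZ); rewrite ?cycle_subG.
- apply/trivgP; rewrite -tiYA subsetI subsetIr andbT.
  apply/subsetP=> g /setIP[/cycleP[i ->] Ai].
  have := subsetP sAW _ Ai; rewrite inE => /andP[_].
  rewrite -expgM -order_dvdn oc => d.
  have /dvdnP[k ->] : 2 %| i by rewrite -(@dvdn_pmul2r 2).
  by rewrite mulnC expgM c2 mem_cycle.
Qed.

Lemma unique_square_split (gT : finGroupType) (G : {group gT}) y :
  unique_square G y ->
  exists c, exists A E : {group gT},
    [/\ 2.-abelem A, (<[c]> <*> E) \x A = G, c \in 'C(E), <[c]> :&: E = <[y]>
      & (c = y \/ c ^+ 2 = y) /\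
        (E :=: <[y]> \/ [/\ 2.-group E, extraspecial E & 'Z(E) = <[y]>])].
Proof.
move=> uG; have [oy Gy] := unique_square_order2 uG.
have [sqG y1 [h Gh h2]] := uG.
have y2 : y ^+ 2 = 1 by rewrite -oy expg_order.
have pG : 2.-group G.
  rewrite -pnat_exponent; apply: (@pnat_dvd _ 4) => //.
  apply/exponentP=> g Gg; rewrite (expgM g 2 2).
  by have := sqG g Gg; rewrite !inE => /orP[] /eqP->; rewrite ?expg1n.
(* A conjugate of [y] is again a nontrivial square, hence equal to [y]. *)
have Zy : y \in 'Z(G).
  rewrite inE Gy; apply/centP=> g Gg; apply/commgP/conjg_fixP.
  have := sqG _ (groupJ Gh Gg); rewrite -conjXg h2 !inE conjg_eq1 (negPf y1).
  by move/eqP.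
have sYZ : <[y]> \subset 'Z(G) by rewrite cycle_subG.
have nYG : G \subset 'N(<[y]>).
  by apply: cents_norm; rewrite centsC; apply: subset_trans sYZ (subsetIr _ _).
have abQ : 2.-abelem (G / <[y]>).
  apply/exponent2_abelem/exponentP=> _ /morphimP[g Ng Gg ->].
  rewrite -morphX //; apply/coset_id; rewrite cycle2g //; exact: sqG.
have [C defC] := abelem_split_dprod abQ (quotientS <[y]> (center_sub G)).
have [_ /= ZC _ tiZC] := dprodP defC.
have sCG : C \subset G / <[y]> by rewrite -ZC mulG_subr.
have nsYG : <[y]> <| G by rewrite /normal cycle_subG Gy.
(* [E] is the preimage of the complement [C] to the image of the centre in the elementary abelian
   quotient by [<[y]>]. *)
have [E defE sYE sEG] := inv_quotientS nsYG sCG.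
have nYZ := subset_trans (center_sub G) nYG.
have nYE := subset_trans sEG nYG.
have tiZE : 'Z(G) :&: E = <[y]>.
  apply/eqP; rewrite eqEsubset subsetI sYZ sYE andbT -quotient_sub1.
    by rewrite (subset_trans (quotientI _ _ _)) // -defE tiZC.
  by rewrite subIset ?nYZ.
have defG : 'Z(G) * E = G.
  apply/eqP; rewrite eqEsubset mul_subG ?center_sub //=.
  by rewrite -(mulSGid sYZ) -mulgA -quotientSK // quotientMl // -defE ZC.
have [c [A [abA defZ cy]]] : exists c, exists A : {group gT},
    [/\ 2.-abelem A, <[c]> \x A = 'Z(G) & c = y \/ c ^+ 2 = y].
  apply: (@abelian_unique_square_split _ 'Z(G)%G) => //; first exact: center_abelian.
  by move=> g /(subsetP (center_sub G)); apply: sqG.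
have [_ /= cA _ ticA] := dprodP defZ.
have Zc : c \in 'Z(G).
  by rewrite -cA; apply: (subsetP (mulG_subl _ _)); apply: cycle_id.
have sAZ : A \subset 'Z(G) by rewrite -cA mulG_subr.
have ycy : <[y]> \subset <[c]>.
  by case: cy => <-; rewrite cycle_subG ?mem_cycle ?cycle_id.
have cEG : G \subset 'C('Z(G)) by rewrite centsC subsetIr.
have cEc : c \in 'C(E) by apply: (subsetP _ _ Zc); rewrite subIset // (centS sEG) orbT.
have defK : <[c]> <*> E = <[c]> * E.
  by rewrite cent_joinEr // centsC cycle_subG.
exists c, A, E; split=> //.
- rewrite dprodE.
  + have nAE : E \subset 'N(A).
      by apply/cents_norm/(subset_trans sEG)/(subset_trans cEG)/centS.
    by rewrite /= defK -mulgA (normC nAE) mulgA cA.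
  + apply: subset_trans sAZ (subset_trans (subsetIr _ _) (centS _)).
    by rewrite join_subG cycle_subG sEG (subsetP (center_sub G)).
  (* As [A] is central, only the central part of [<[c]> * E] can meet it; by the modular law that
     part is [<[c]> * <[y]>], which is [<[c]>]. *)
  + rewrite /= defK -(setIidPr sAZ) setIA.
    rewrite -group_modl ?cycle_subG // [E :&: _]setIC tiZE mulGSid // ticA.
- apply/eqP; rewrite eqEsubset; apply/andP; split.
    by rewrite -tiZE setSI // cycle_subG.
  by rewrite subsetI; apply/andP.
split=> //.
have [sEZ | nEZ] := boolP (E \subset 'Z(G)).
  by left; rewrite -tiZE (setIidPr sEZ).
right.
(* An element of ['Z(E)] commutes with [E] and with ['Z(G)], whose product is [G]; it thus lies in
   the intersection of ['Z(G)] and [E]. *)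
have defZE : 'Z(E) = <[y]>.
  apply/eqP; rewrite eqEsubset; apply/andP; split.
    rewrite -tiZE subsetI center_sub andbT subsetI.
    rewrite (subset_trans (center_sub E) sEG) -[in 'C(_)]defG centM subsetI.
    rewrite subsetIr andbT (subset_trans (center_sub E)) //.
    exact: subset_trans sEG cEG.
  rewrite subsetI sYE (subset_trans sYZ) // subIset //.
  by rewrite (centS sEG) orbT.
have pE := pgroupS sEG pG.
split=> //; apply/(extraspecial_central_quotient _ pE) => //; split.
- by rewrite defZE -orderE.
- rewrite defZE -subG1 quotient_sub1 //; apply: contra nEZ => sEY.
  exact: subset_trans sEY sYZ.
- by rewrite defZE; apply: abelemS abQ; apply: quotientS.
Qed.

(** * Assembling the classification *)

Lemma hits_squares_C2pow_setX (gT rT : finGroupType) (G : {group gT})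
    (H : {group rT}) j :
  G \isog setX (C2pow j) H -> (exists y, unique_square H y) ->
  exists y, hits_squares G y.
Proof.
move=> isoG [y uH]; apply: hits_squares_isog isoG _; exists (1, y).
exact/unique_square_hits/unique_square_setX/uH/C2pow_sqr.
Qed.

Lemma abelem_dprod_isog (gT rT : finGroupType) (A G K : {group gT})
    (H : {group rT}) :
  2.-abelem A -> K \x A = G -> K \isog H -> exists j, G \isog setX (C2pow j) H.
Proof.
move=> abA defG isoK; have [j isoA] := abelem_isog_C2pow abA; exists j.
rewrite dprodC in defG; apply: isog_dprod defG (setX_dprod _ _) _ _.
  by rewrite (isog_transl _ isoA) isog_setX1.
by rewrite (isog_transl _ isoK) isog_set1X.
Qed.

Theorem theorem10 (gT : finGroupType) (G : {group gT}) :
  (s_two G + 2 = #|G|)%N <->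
  [\/ G \isog [set: 'Z_3],
      G \isog 'D_6,
      exists j : nat, G \isog setX (C2pow j) [set: 'Z_4]
    | (exists (j : nat) (eT : finGroupType) (E : {group eT}),
        [/\ 2.-group E, extraspecial E & G \isog setX (C2pow j) E]) \/
      (exists (j : nat) (eT : finGroupType) (E : {group eT})
              (x : 'Z_4) (z : eT),
        [/\ 2.-group E, extraspecial E, generator [set: 'Z_4] x,
            generator 'Z(E) z & G \isog setX (C2pow j) (C4_cprod E x z)])].
Proof.
have gen4 : generator [set: 'Z_4] Zp1 by rewrite /generator; apply/eqP/Zp_cycle.
apply: (iff_trans (s_two_hitting G)); split.
  case=> y hy; have [y2 | y2] := eqVneq (y ^+ 2) 1; last first.
    by have [isoG | isoG] := hits_squares_order3 hy y2; [constructor 1 | constructor 2].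
  have [/setD1P[y1 Gy] hity [g Gg g2]] := hy.
  have uG : unique_square G y.
    split=> //.
      move=> h Gh; have := hity h Gh; rewrite !inE.
      by case/orP=> // /eqP->; rewrite y2 eqxx.
    exists g => //; have := hity g Gg; rewrite (negPf g2) /=.
    by case/orP=> /eqP // gy; rewrite gy y2 eqxx in g2.
  have [oy _] := unique_square_order2 uG.
  have [c [A [E [abA defG cEc tiE [cy defE]]]]] := unique_square_split uG.
  have Ey : y \in E by have := cycle_id y; rewrite -tiE => /setIP[].
  have oc4 : c ^+ 2 = y -> #[c] = 4.
    by move=> c2; rewrite (@orderXprime _ 2 2 c) ?c2 ?oy.
  case: cy => [defc | c2]; case: defE => [defE | [pE esE defZE]].
  (* Both factors degenerate: [G] is [<[y]> \x A], elementary abelian, against [g ^+ 2 != 1]. *)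
  - rewrite /= defc defE (joing_idPl (subxx _)) in defG.
    have: 2.-abelem G by rewrite (dprod_abelem _ defG) abA andbT prime_abelem.
    by case/abelemP=> // _ /(_ g Gg)/eqP; rewrite (negPf g2).
  (* Here [c = y] is absorbed by [E]. *)
  - constructor 4; left; rewrite /= defc (joing_idPr _) ?cycle_subG // in defG.
    have [j isoG] := abelem_dprod_isog abA defG (isog_refl E).
    by exists j, gT, E.
  (* Here [E] is generated by [c ^+ 2], so [<[c]> <*> E] is cyclic of order 4. *)
  - constructor 3; apply: abelem_dprod_isog abA defG _.
    rewrite /= defE (joing_idPl _) -?c2 ?cycleX //.
    rewrite isog_cyclic_card ?cycle_cyclic // -orderE oc4 // cardsT card_ord.
    by rewrite eqxx andbT; apply/cyclicP; exists Zp1; apply: Zp_cycle.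
  - constructor 4; right; rewrite -{}c2 in oc4 tiE defZE *.
    have isoK := C4_cprod_isog (oc4 erefl) cEc tiE.
    have [j isoG] := abelem_dprod_isog abA defG isoK.
    exists j, gT, E, Zp1, (c ^+ 2); split=> //.
    by rewrite /generator defZE.
case=> [isoG | isoG | [j isoG] | [[j [eT [E [pE esE isoG]]]] |
  [j [eT [E [x [z [pE esE gx gz isoG]]]]]]]].
- exact: hits_squares_isog isoG hits_squares_C3.
- exact: hits_squares_isog isoG hits_squares_D6.
- apply: hits_squares_C2pow_setX isoG _; exists (Zp1 ^+ 2).
  by rewrite /= (eqP gen4); apply/unique_square_cycle4/generator_Z4.
- apply: hits_squares_C2pow_setX isoG _.
  have /cyclicP[z defZ] : cyclic 'Z(E) by case: esE => _ /prime_cyclic.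
  by exists z; apply: extraspecial_unique_square => //; apply/eqP.
- exact: hits_squares_C2pow_setX isoG (C4_cprod_unique_square pE esE gx gz).
Qed.
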